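(* Let $P$ be a natural unit interval order on $[n]$. Then $X_{\mathrm{inc}(P)}(\mathbf x,t)$ is a palindromic polynomial in $t$.
   Context: A natural unit interval order is a poset $P$ on $[n]$ such that (1) $x<_P y$ implies $x<y$ as integers, and (2) whenever the disjoint union of a chain $x<_P z$ and an element $y$ (incomparable to both) is an induced subposet of $P$, then $x<y<z$ as integers. $\mathrm{inc}(P)$ is the incomparability graph of $P$. For a graph $G$ on $[n]$, a proper coloring is $c:[n]\to\mathbb P$ with $c(i)\ne c(j)$ for $\{i,j\}\in E(G)$; $C(G)$ is the set of proper colorings, $\mathbf x_c=\prod_i x_{c(i)}$, $\mathrm{asc}(c)=|\{\{i,j\}\in E(G):i<j,\ c(i)<c(j)\}|$, and $X_G(\mathbf x,t)=\sum_{c\in C(G)}t^{\mathrm{asc}(c)}\mathbf x_c$. A polynomial $a_0+a_1t+\cdots+a_dt^d$ (here with coefficients symmetric functions, $a_d\neq 0$) is palindromic if $a_j=a_{d-j}$ for all $0\le j\le d$. *)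

(* Defs.v *)
From HB Require Import structures.
From mathcomp Require Import all_boot all_order all_algebra finmap.
From mathcomp Require Import mathcomp_extra boolp classical_sets functions.
From mathcomp Require Import cardinality fsbigop.
From mathcomp.multinomials Require Import monalg.

Set Implicit Arguments.
Unset Strict Implicit.
Unset Printing Implicit Defensive.

Import GRing.Theory.
Local Open Scope ring_scope.

(* The set [n] = {1, ..., n} is represented by 'I_n and the set of positive
   integers by nat, both through the order isomorphism k |-> k - 1. *)

Record simple_graph (n : nat) := SimpleGraph {
  adj :> rel 'I_n;
  adj_sym : symmetric adj;
  adj_irr : irreflexive adj
}.

Record poset (n : nat) := Poset {
  plt :> rel 'I_n;
  plt_irr : irreflexive plt;
  plt_trans : transitive plt
}.

Definition incomparable (n : nat) (P : poset n) : rel 'I_n :=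
  fun x y => [&& x != y, ~~ P x y & ~~ P y x].

Definition natural_unit_interval_order (n : nat) (P : poset n) : Prop :=
  (forall x y : 'I_n, P x y -> (x < y)%N) /\
  (forall x y z : 'I_n,
     P x z -> incomparable P y x -> incomparable P y z -> (x < y < z)%N).

Lemma incomparable_sym (n : nat) (P : poset n) : symmetric (incomparable P).
Proof. by move=> x y; rewrite /incomparable eq_sym; congr (_ && _); rewrite andbC. Qed.

Lemma incomparable_irr (n : nat) (P : poset n) : irreflexive (incomparable P).
Proof. by move=> x; rewrite /incomparable eqxx. Qed.

Definition inc (n : nat) (P : poset n) : simple_graph n :=
  SimpleGraph (@incomparable_sym n P) (@incomparable_irr n P).

Definition proper_coloring (n : nat) (G : simple_graph n)
    (c : {ffun 'I_n -> nat}) : Prop :=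
  forall i j : 'I_n, G i j -> c i != c j.

(* Each edge {i, j} is counted once, as the pair (i, j) with i < j. *)
Definition asc (n : nat) (G : simple_graph n) (c : {ffun 'I_n -> nat}) : nat :=
  #|[set p : 'I_n * 'I_n |
      [&& G p.1 p.2, (p.1 < p.2)%N & (c p.1 < c p.2)%N]]|.

Definition color_monomial (n : nat) (c : {ffun 'I_n -> nat}) : {cmonom nat} :=
  \big[mmul/mone]_(i < n) ucm (c i).

(* Formal power series in the variables x_0, x_1, ... with coefficients in R:
   a series is the function giving the coefficient of each monomial. *)
Definition power_series (R : Type) : Type := {cmonom nat} -> R.

(* X_G(x, t) as an element of Z[t][[x]]. The index set of the sum is finite, by
   [finite_color_monomial] below, so this is not the default value of an
   infinite finitely supported sum. *)
Definition chromatic_qsym (n : nat) (G : simple_graph n) :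
    power_series {poly int} :=
  fun m => \sum_(c \in [set c : {ffun 'I_n -> nat} |
                         proper_coloring G c /\ color_monomial c = m]%classic)
             ('X^(asc G c) : {poly int}).

Lemma color_monomialE (n : nat) (c : {ffun 'I_n -> nat}) (k : nat) :
  color_monomial c k = #|[set i | c i == k]|.
Proof.
rewrite /color_monomial -sum1dep_card [RHS]big_mkcond /=.
rewrite (big_morph (fun m : {cmonom nat} => m k) (cmM k)
           (cm1 k)).
by apply: eq_bigr => i _; rewrite cmU; case: eqP.
Qed.

Lemma finite_color_monomial (n : nat) (m : {cmonom nat}) :
  finite_set [set c : {ffun 'I_n -> nat} | color_monomial c = m]%classic.
Proof.
pose f (g : {ffun 'I_n -> finsupp m}) : {ffun 'I_n -> nat} :=
  [ffun i => val (g i)].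
apply: (@sub_finite_set _ _ (f @` setT)%classic); last first.
  exact/finite_image/finite_finset.
move=> c /= cm.
have cP i : c i \in finsupp m.
  rewrite mem_finsupp -cm color_monomialE -lt0n card_gt0.
  by apply/set0Pn; exists i; rewrite inE.
exists [ffun i => FSetSub (cP i)] => //.
by apply/ffunP => i; rewrite !ffunE.
Qed.

(* Symmetric functions over Z: series of bounded degree that are invariant
   under every permutation of the variables. *)
Definition symmetric_function (f : power_series int) : Prop :=
  (exists D : nat, forall m, f m != 0 -> (mdeg m <= D)%N) /\
  (forall (s : nat -> nat) (m m' : {cmonom nat}),
     bijective s -> (forall k, m' k = m (s k)) -> f m' = f m).

(* F = a_0 + a_1 t + ... + a_d t^d with each a_j a symmetric function,
   a_d nonzero, and a_j = a_(d - j). *)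
Definition palindromic (F : power_series {poly int}) : Prop :=
  exists (d : nat) (a : nat -> power_series int),
    [/\ forall m, F m = \poly_(j < d.+1) a j m,
        forall j, (j <= d)%N -> symmetric_function (a j),
        exists m, a d m != 0
      & forall j, (j <= d)%N -> a j =1 a (d - j)%N].

(* Main.v *)
From mathcomp Require Import all_boot all_algebra finmap.
From mathcomp Require Import boolp classical_sets functions.
From mathcomp Require Import cardinality fsbigop.
From mathcomp.multinomials Require Import monalg.
From mathcomp Require Import zify.
Require Import Defs.

(* Let G = inc(P). If x < y < z and x, z are adjacent in G, then so are x, y and
   y, z. Hence in a proper coloring the vertices colored a or a + 1, listed in
   increasing order, are adjacent only when consecutive (else there would be a
   two-colored triangle), so they form increasing paths with alternating colors.
   Exchanging a and a + 1 on the paths with an odd number of vertices keeps the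
   number of ascents, since such a path has as many ascents as descents, and
   exchanges the multiplicities of a and a + 1, since even paths use both colors
   equally often. Thus X_G is symmetric. Reversing the order of the colors turns
   ascents into descents, so together with the symmetry the coefficients of t^j
   and of t^(|E| - j) agree; the coloring i |-> i has |E| ascents. *)

Set Implicit Arguments.
Unset Strict Implicit.
Unset Printing Implicit Defensive.

Import GRing.Theory Num.Theory.
Local Open Scope nat_scope.

Lemma adjacent_swap_perm_subst (T : eqType) (U : Type) (F : seq T -> U) :
    (forall s1 x y s2, F (s1 ++ x :: y :: s2) = F (s1 ++ y :: x :: s2)) ->
  forall s s', perm_eq s s' -> F s = F s'.
Proof.
move=> swapF.
have move_front p s1 x s2 : F (p ++ s1 ++ x :: s2) = F (p ++ x :: s1 ++ s2).
  by elim: s1 p => // y s1 IHs p; rewrite /= -cat_rcons IHs cat_rcons swapF.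
apply: catCA_perm_subst => s1 s2 s3.
suff catCA p : F (p ++ s1 ++ s2 ++ s3) = F (p ++ s2 ++ s1 ++ s3).
  exact: (catCA [::]).
elim: s2 p => // x s2 IHs p.
by rewrite cat_cons move_front -!cat_rcons IHs cat_rcons.
Qed.

Lemma perm_filter_predC1 (T : eqType) (x0 : T) (s s' : seq T) :
    size s = size s' ->
    perm_eq [seq x <- s | x != x0] [seq x <- s' | x != x0] -> perm_eq s s'.
Proof.
have filter_x0 t :
    [seq x <- t | predC (predC1 x0) x]
      = nseq (size t - size (filter (predC1 x0) t)) x0.
  rewrite size_filter -(count_predC (predC1 x0) t) addKn -size_filter.
  by apply/all_pred1P/allP => x; rewrite mem_filter => /andP[/negPn].
move=> eq_size eq_perm; rewrite -(perm_filterC (predC1 x0) s) perm_sym.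
rewrite -(perm_filterC (predC1 x0) s') perm_sym !filter_x0.
by rewrite eq_size (perm_size eq_perm) perm_cat2r.
Qed.

Lemma perm_mkseq_comp (T : eqType) (x0 : T) (m : nat -> T) (s : nat -> nat) N :
    bijective s -> (forall k, N <= k -> m k = x0) ->
    (forall k, N <= k -> m (s k) = x0) ->
  perm_eq (mkseq (m \o s) N) (mkseq m N).
Proof.
move=> [s' sK s'K] m_x0 ms_x0; apply: (@perm_filter_predC1 _ x0).
  by rewrite !size_mkseq.
rewrite /mkseq !filter_map map_comp; apply/perm_map/uniq_perm.
- by rewrite (map_inj_uniq (can_inj sK)) filter_uniq ?iota_uniq.
- by rewrite filter_uniq ?iota_uniq.
move=> k; rewrite -[k in LHS]s'K (mem_map (can_inj sK)).
rewrite !mem_filter /= s'K !mem_iota.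
case: eqVneq => //= mk; apply/idP/idP=> _; rewrite ltnNge /=.
  by apply: contraNN mk => /m_x0->.
by apply: contraNN mk => /ms_x0; rewrite s'K => ->.
Qed.

Lemma nth_mkseq_default (T : Type) (x0 : T) (m : nat -> T) N :
  (forall k, N <= k -> m k = x0) -> nth x0 (mkseq m N) =1 m.
Proof.
move=> m_x0 k; case: (ltnP k N) => [ltk | lek]; first by rewrite nth_mkseq.
by rewrite nth_default ?size_mkseq // m_x0.
Qed.

Lemma mem_flatten_filter (T : eqType) (p : pred (seq T)) (ss : seq (seq T))
    r x :
    uniq (flatten ss) -> r \in ss -> x \in r ->
  (x \in flatten [seq r' <- ss | p r']) = p r.
Proof.
elim: ss => //= r0 ss IHss; rewrite cat_uniq => /and3P[_ /hasPn r0_ss uniq_ss].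
rewrite inE => /orP[/eqP-> | r_ss] xr; last first.
  have /r0_ss/negPf xr0 : x \in flatten ss by apply/flattenP; exists r.
  by case: ifP => _; rewrite /= ?mem_cat ?[x \in r0]xr0 IHss.
case: ifP => _ /=; first by rewrite mem_cat xr.
apply/flattenP => -[r']; rewrite mem_filter => /andP[_ r'_ss] xr'.
have /r0_ss/negP[] : x \in flatten ss by apply/flattenP; exists r'.
exact: xr.
Qed.

Definition consecutive_count (T : Type) (q : rel T) (s : seq T) : nat :=
  if s is x :: s' then count id (pairmap q x s') else 0.

Lemma consecutive_count_map (T U : Type) (f : T -> U) (q : rel U) s :
  consecutive_count q (map f s) = consecutive_count (relpre f q) s.
Proof.
by case: s => // x s; congr count; elim: s x => //= y s IHs x; rewrite IHs.
Qed.

Section Runs.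

Variables (T : eqType) (e : rel T).

Fixpoint runs (s : seq T) : seq (seq T) :=
  if s is x :: s' then
    if runs s' is (y :: r) :: rs then
      if e x y then (x :: y :: r) :: rs else [:: x] :: (y :: r) :: rs
    else [:: [:: x]]
  else [::].

Lemma runs_cons2 x y s : exists r rs,
  runs (y :: s) = (y :: r) :: rs /\
  runs (x :: y :: s) =
    if e x y then (x :: y :: r) :: rs else [:: x] :: (y :: r) :: rs.
Proof.
suff [r [rs runs_ys]] : exists r rs, runs (y :: s) = (y :: r) :: rs.
  by exists r, rs; rewrite [runs (x :: _)]/= -/(runs (y :: s)) runs_ys.
rewrite /=; case: (runs s) => [|[|z r] rs]; try by exists [::], [::].
by case: ifP => _; [exists (z :: r), rs | exists [::], ((z :: r) :: rs)].
Qed.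

Lemma flatten_runs s : flatten (runs s) = s.
Proof.
elim: s => // x [//|y s] IHs; have [r [rs [runs_ys ->]]] := runs_cons2 x y s.
by move: IHs; rewrite runs_ys; case: ifP => _ [/= ->].
Qed.

Lemma all_sorted_runs (q : rel T) s :
  all (sorted q) (runs s) = sorted (fun x y => e x y ==> q x y) s.
Proof.
elim: s => // x [//|y s] IHs; have [r [rs [runs_ys ->]]] := runs_cons2 x y s.
rewrite [RHS]/= -[path _ _ _]/(sorted _ (y :: s)) -IHs runs_ys.
by case: ifP => exy //=; rewrite -andbA.
Qed.

Lemma consecutive_count_runs (q : rel T) s :
  consecutive_count (fun x y => e x y && q x y) s
    = \sum_(r <- runs s) consecutive_count q r.
Proof.
elim: s => [|x [|y s] IHs]; rewrite ?big_nil ?big_seq1 //.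
have [r [rs [runs_ys ->]]] := runs_cons2 x y s.
rewrite [LHS]/= -[count _ _]/(consecutive_count _ (y :: s)) IHs runs_ys.
by case: ifP => exy; rewrite !big_cons /= ?addnA.
Qed.

Definition odd_runs (s : seq T) : seq T :=
  flatten [seq r <- runs s | odd (size r)].

Lemma mem_odd_runs s r x :
  uniq s -> r \in runs s -> x \in r -> (x \in odd_runs s) = odd (size r).
Proof. by move=> uniq_s; apply: mem_flatten_filter; rewrite flatten_runs. Qed.

End Runs.

Section Chordless.

Variables (T : eqType) (e : rel T).

Fixpoint chordless (s : seq T) : bool :=
  if s is x :: s' then ~~ has (e x) (behead s') && chordless s' else true.

Lemma pairwise_chordless (lt : rel T) s : pairwise lt s ->
    {in s & &, forall x y z, lt x y -> lt y z -> ~~ e x z} ->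
  chordless s.
Proof.
elim: s => //= x s IHs /andP[/allP lt_x lt_s] no_chord; apply/andP; split.
  case: s {IHs} lt_x lt_s no_chord => //= y s lt_x /andP[/allP lt_y _] no_chord.
  apply/hasPn => z zs; apply: (no_chord x y z); rewrite ?inE ?eqxx ?zs ?orbT //.
    by apply: lt_x; rewrite mem_head.
  exact: lt_y.
apply: IHs => // u v w us vs ws.
by apply: no_chord; rewrite inE ?us ?vs ?ws orbT.
Qed.

Lemma chordless_pairwise (q : rel T) s : chordless s ->
  pairwise (fun x y => e x y ==> q x y) s
    = sorted (fun x y => e x y ==> q x y) s.
Proof.
elim: s => //= x s IHs /andP[no_chord /IHs->].
case: s no_chord {IHs} => //= y s /hasPn no_chord.
rewrite -andbA; congr (_ && _); rewrite andb_idl // => _.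
by apply/allP => z /no_chord/negPf->.
Qed.

Lemma chordless_sum_edges (lt q : rel T) s :
    (forall x y, lt x y -> ~~ lt y x) -> pairwise lt s -> chordless s ->
  \sum_(x <- s) \sum_(y <- s) [&& lt x y, e x y & q x y]
    = consecutive_count (fun x y => e x y && q x y) s.
Proof.
move=> lt_asym; elim: s => [|x s IHs]; first by rewrite big_nil.
move=> /= /andP[/allP lt_x lt_s] /andP[no_chord chordless_s].
have lt_xx : lt x x = false by apply/negP => /[dup] /lt_asym/negP.
rewrite big_cons big_cons lt_xx add0n.
have -> : \sum_(z <- s) \sum_(y <- x :: s) [&& lt z y, e z y & q z y]
    = consecutive_count (fun x y => e x y && q x y) s.
  rewrite -IHs //; apply: eq_big_seq => z zs.
  by rewrite big_cons (negPf (lt_asym _ _ (lt_x z zs))).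
case: s lt_x no_chord {IHs lt_s chordless_s} => [|y s] lt_x /hasPn no_chord.
  by rewrite big_nil.
rewrite big_cons lt_x ?mem_head // big1_seq ?addn0 // => z /no_chord/negPf->.
by rewrite andbF.
Qed.

End Chordless.

Section TwoLetterWords.

Variable a : nat.
Implicit Types (k : nat) (w : seq nat).

Definition swap_colors k : nat :=
  if k == a then a.+1 else if k == a.+1 then a else k.

Lemma swap_colorsK : involutive swap_colors.
Proof. by move=> k; rewrite /swap_colors; do ![case: ifP]; lia. Qed.

Lemma mem_swap_colors k :
  (swap_colors k \in [:: a; a.+1]) = (k \in [:: a; a.+1]).
Proof. by rewrite !inE /swap_colors; do ![case: ifP]; lia. Qed.

Lemma swap_colors_id k : k \notin [:: a; a.+1] -> swap_colors k = k.
Proof. by rewrite !inE /swap_colors; do ![case: ifP]; lia. Qed.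

Definition alternating w : bool :=
  sorted (fun i j => i != j) w && all [in [:: a; a.+1]] w.

Lemma alternating_cons2 k j w :
  alternating [:: k, j & w] = (k == swap_colors j) && alternating (j :: w).
Proof.
rewrite /alternating /= !inE /swap_colors; case: path; last by rewrite !andbF.
by case: all; rewrite ?andbF //=; do ![case: ifP]; lia.
Qed.

Lemma alternating_head k w : alternating (k :: w) -> k \in [:: a; a.+1].
Proof. by case/andP=> _ /andP[]. Qed.

Lemma consecutive_asc_alternating k w : alternating (k :: w) ->
  consecutive_count ltn (k :: w) = (size w + (k == a))./2.
Proof.
elim: w k => [|j w IHw] k; first by case: (k == a).
rewrite alternating_cons2 => /andP[/eqP-> alt_jw].
have ja := alternating_head alt_jw; have asc_jw := IHw _ alt_jw.
rewrite [LHS]/= -[count _ _]/(consecutive_count ltn (j :: w)) asc_jw /=.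
by move: ja; rewrite !inE /swap_colors; do ![case: ifP]; lia.
Qed.

Lemma count_mem_alternating k w i :
    alternating (k :: w) -> i \in [:: a; a.+1] ->
  count_mem i (k :: w) = ((size w).+1 + (k == i))./2.
Proof.
move=> alt_kw ia; elim: w k alt_kw => [|j w IHw] k.
  by rewrite /=; case: (k == i).
rewrite alternating_cons2 => /andP[/eqP-> alt_jw].
have ja := alternating_head alt_jw; have count_jw := IHw _ alt_jw.
rewrite -cat1s count_cat count_jw /=.
by move: ja ia; rewrite !inE /swap_colors; do ![case: ifP]; lia.
Qed.

Definition swap_word w : seq nat :=
  if odd (size w) then map swap_colors w else w.

Lemma alternating_swap_word w : alternating w -> alternating (swap_word w).
Proof.
rewrite /swap_word; case: ifP => // _ /andP[sorted_w w_a]; apply/andP; split.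
  rewrite sorted_map (eq_sorted (e' := fun i j => i != j)) // => i j /=.
  by rewrite (inj_eq (inv_inj swap_colorsK)).
rewrite all_map (eq_all (a2 := [in [:: a; a.+1]])) // => i.
exact: mem_swap_colors.
Qed.

Lemma consecutive_asc_swap_word w : alternating w ->
  consecutive_count ltn (swap_word w) = consecutive_count ltn w.
Proof.
move=> alt_w; have := alternating_swap_word alt_w; rewrite /swap_word.
case: ifP => //; case: w alt_w => // k w alt_kw odd_kw alt_swap_kw.
rewrite consecutive_asc_alternating // consecutive_asc_alternating // size_map.
by move: odd_kw => /=; case: (_ == _); case: (_ == _); lia.
Qed.

Lemma count_mem_swap_word w k : alternating w -> k \in [:: a; a.+1] ->
  count_mem k (swap_word w) = count_mem (swap_colors k) w.
Proof.
move=> alt_w ka; rewrite /swap_word; case: ifP => [_|].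
  rewrite count_map; apply: eq_count => i /=.
  by rewrite -(inj_eq (inv_inj swap_colorsK)) swap_colorsK.
case: w alt_w => // i w alt_iw odd_iw.
rewrite !count_mem_alternating ?mem_swap_colors //.
by move: odd_iw => /=; case: (_ == _); case: (_ == _); lia.
Qed.

End TwoLetterWords.

Lemma nth_cat_swap (T : Type) (x0 : T) (s1 : seq T) x y s2 k :
  nth x0 (s1 ++ y :: x :: s2) k
    = nth x0 (s1 ++ x :: y :: s2) (swap_colors (size s1) k).
Proof.
rewrite /swap_colors !nth_cat.
case: eqVneq => [-> | k_neq]; first by rewrite ltnn subnn ltnNge leqnSn subSnn.
case: eqVneq => [-> | k_neqS]; first by rewrite ltnn subnn ltnNge leqnSn subSnn.
case: ltnP => // le_k; have ltSk : (size s1).+1 < k.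
  by rewrite !ltn_neqAle ![_ == k]eq_sym k_neqS k_neq.
by rewrite -(subnKC ltSk) addSnnS addSnnS addKn.
Qed.

Definition unit_interval_graph (n : nat) (G : simple_graph n) : Prop :=
  forall x y z : 'I_n, x < y -> y < z -> G x z -> G x y && G y z.

Lemma incomparable_ltn n (P : poset n) (x y : 'I_n) :
  natural_unit_interval_order P -> x < y -> incomparable P x y = ~~ P x y.
Proof.
move=> [P_lt _] xy.
have neq_xy : x != y by apply: contraTneq xy => ->; rewrite ltnn.
have nPyx : ~~ P y x.
  by apply: contraL xy => /P_lt; rewrite -leqNgt; apply: ltnW.
by rewrite /incomparable neq_xy nPyx andbT.
Qed.

Lemma inc_unit_interval_graph n (P : poset n) :
  natural_unit_interval_order P -> unit_interval_graph (inc P).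
Proof.
move=> P_nuio x y z xy yz Gxz; have xz := ltn_trans xy yz.
have P_unit := P_nuio.2; have nPxz : ~~ P x z by rewrite -incomparable_ltn.
rewrite /= !incomparable_ltn //; apply/andP; split; apply/negP => Puv.
  have Gyz : incomparable P y z.
    rewrite incomparable_ltn //.
    by apply: contraNN nPxz; apply: plt_trans.
  have /andP[_] : x < z < y by apply: P_unit Puv _ _; rewrite incomparable_sym.
  by rewrite ltnNge ltnW.
have Gxy : incomparable P x y.
  rewrite incomparable_ltn //.
  by apply: contraNN nPxz => Pxy; apply: plt_trans Puv.
by have /andP[] := P_unit y x z Puv Gxy Gxz; rewrite ltnNge (ltnW xy).
Qed.

Section Colorings.

Variables (n : nat) (G : simple_graph n).
Implicit Types (c : {ffun 'I_n -> nat}) (i j x y : 'I_n).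

Definition content c (k : nat) : nat := #|[set i | c i == k]|.

Lemma asc_sum_split c (s : seq 'I_n) : uniq s ->
  asc G c = \sum_(x <- s) \sum_(y <- s) [&& x < y, G x y & c x < c y]
    + \sum_(p | ~~ ((p.1 \in s) && (p.2 \in s)))
        [&& p.1 < p.2, G p.1 p.2 & c p.1 < c p.2].
Proof.
move=> uniq_s; rewrite big_uniq //; under eq_bigr do rewrite big_uniq //.
rewrite pair_big -[RHS](bigID (fun p => (p.1 \in s) && (p.2 \in s)) predT) /=.
rewrite /asc -sum1dep_card big_mkcond.
by apply: eq_bigr => p _; rewrite andbCA; case: ifP.
Qed.

Definition edges : {set 'I_n * 'I_n} := [set p | G p.1 p.2 & p.1 < p.2].

Lemma asc_le_edges c : asc G c <= #|edges|.
Proof.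
by apply/subset_leq_card/fintype.subsetP => p; rewrite !inE => /and3P[-> ->].
Qed.

Definition reverse_coloring (N : nat) c : {ffun 'I_n -> nat} :=
  [ffun i => N - (c i).+1].

Lemma reverse_coloringK N c : (forall i, c i < N) ->
  reverse_coloring N (reverse_coloring N c) = c.
Proof.
by move=> ltcN; apply/ffunP => i; rewrite !ffunE subnSK // subKn // ltnW.
Qed.

Lemma reverse_coloring_proper N c : (forall i, c i < N) ->
  proper_coloring G c -> proper_coloring G (reverse_coloring N c).
Proof.
move=> ltcN c_proper i j Gij; rewrite !ffunE.
by move: (c_proper _ _ Gij) (ltcN i) (ltcN j); lia.
Qed.

Lemma asc_reverse_coloring N c : (forall i, c i < N) -> proper_coloring G c ->
  asc G (reverse_coloring N c) = #|edges| - asc G c.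
Proof.
move=> ltcN c_proper; rewrite -(cardsID [set p | c p.1 < c p.2] edges).
have -> : asc G c = #|edges :&: [set p | c p.1 < c p.2]|.
  by apply: eq_card => p; rewrite !inE andbA.
rewrite addKn; apply: eq_card => p; rewrite !inE !ffunE.
case: (boolP (G p.1 p.2)) => [Gp|]; rewrite ?andbF //=.
by move: (c p.1) (c p.2) (c_proper _ _ Gp) (ltcN p.1) (ltcN p.2) => u v; lia.
Qed.

Lemma color_monomial_content c (m : {cmonom nat}) :
  color_monomial c = m <-> content c =1 m.
Proof.
split=> [<- k | cm]; first by rewrite color_monomialE.
by apply/eqP/cmP => k; rewrite color_monomialE -cm.
Qed.

Lemma content_lt (s : seq nat) c :
  content c =1 nth 0 s -> forall i, c i < size s.
Proof.
move=> cs i; rewrite ltnNge; apply/negP => le_s.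
have := cs (c i); rewrite nth_default // => /card0_eq/(_ i).
by rewrite !inE eqxx.
Qed.

Lemma content_reverse_coloring (s : seq nat) c : content c =1 nth 0 s ->
  content (reverse_coloring (size s) c) =1 nth 0 (rev s).
Proof.
move=> cs k; have ltcs := content_lt cs; case: (ltnP k (size s)) => [ltk | lek].
  rewrite nth_rev // -cs; apply: eq_card => i; rewrite !inE ffunE.
  by move: (ltcs i); lia.
rewrite nth_default ?size_rev //; apply: eq_card0 => i.
by rewrite !inE ffunE; move: (ltcs i); lia.
Qed.

End Colorings.

Section OddRunSwap.

Variables (n : nat) (G : simple_graph n) (a : nat).
Hypothesis G_interval : unit_interval_graph G.
Implicit Types (c : {ffun 'I_n -> nat}) (x y z : 'I_n).

Definition two_colored c : seq 'I_n :=
  [seq x <- enum 'I_n | c x \in [:: a; a.+1]].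

(* The involution of Shareshian and Wachs: each run is a connected component,
   in fact an increasing path, of the subgraph colored by [a] and [a.+1]. *)
Definition swap_odd_runs c : {ffun 'I_n -> nat} :=
  [ffun x => if x \in odd_runs G (two_colored c)
             then swap_colors a (c x) else c x].

Lemma mem_two_colored c x : (x \in two_colored c) = (c x \in [:: a; a.+1]).
Proof. by rewrite mem_filter mem_enum andbT. Qed.

Lemma uniq_two_colored c : uniq (two_colored c).
Proof. exact/filter_uniq/enum_uniq. Qed.

Lemma pairwise_ltn_two_colored c : pairwise (relpre val ltn) (two_colored c).
Proof.
apply: pairwise_filter; rewrite -pairwise_map val_enum_ord.
by rewrite -sorted_pairwise ?iota_ltn_sorted //; apply: ltn_trans.
Qed.

Lemma mem_swap_odd_runs c x :
  (swap_odd_runs c x \in [:: a; a.+1]) = (c x \in [:: a; a.+1]).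
Proof. by rewrite ffunE; case: ifP => // _; rewrite mem_swap_colors. Qed.

Lemma two_colored_swap_odd_runs c :
  two_colored (swap_odd_runs c) = two_colored c.
Proof. by apply: eq_filter => x; rewrite mem_swap_odd_runs. Qed.

Lemma swap_odd_runs_id c x : c x \notin [:: a; a.+1] -> swap_odd_runs c x = c x.
Proof. by move=> cx; rewrite ffunE swap_colors_id ?if_same. Qed.

Lemma swap_odd_runsK : involutive swap_odd_runs.
Proof.
move=> c; apply/ffunP => x; rewrite ffunE two_colored_swap_odd_runs ffunE.
by case: (x \in _); rewrite ?swap_colorsK.
Qed.

Lemma swap_odd_runs_ltn c x y :
    ~~ ((c x \in [:: a; a.+1]) && (c y \in [:: a; a.+1])) ->
  (swap_odd_runs c x < swap_odd_runs c y) = (c x < c y).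
Proof.
have [] := (mem_swap_odd_runs c x, mem_swap_odd_runs c y).
have [cx | cx] := boolP (c x \in _); have [cy | cy] := boolP (c y \in _) => //=;
  rewrite ?(swap_odd_runs_id cx) ?(swap_odd_runs_id cy) //.
- by move: cx cy; rewrite !inE; lia.
- by move: cx cy; rewrite !inE; lia.
Qed.

Lemma map_swap_odd_runs c r : r \in runs G (two_colored c) ->
  map (swap_odd_runs c) r = swap_word a (map c r).
Proof.
move=> rc; rewrite /swap_word size_map.
have swap_r x : x \in r ->
    swap_odd_runs c x = if odd (size r) then swap_colors a (c x) else c x.
  by move=> xr; rewrite ffunE (mem_odd_runs (uniq_two_colored c) rc xr).
by case: ifP swap_r => _ swap_r; rewrite -?map_comp; apply/eq_in_map.
Qed.

Lemma content_two_colored c k : k \in [:: a; a.+1] ->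
  content c k = \sum_(r <- runs G (two_colored c)) count_mem k (map c r).
Proof.
move=> ka; under eq_bigr do rewrite count_map.
rewrite -(big_map (count _) xpredT id) -sumnE -count_flatten flatten_runs.
rewrite count_filter /content cardsE cardE size_filter -enumT.
by apply: eq_count => x /=; rewrite andb_idr // => /eqP->.
Qed.

Section ProperColoring.

Variable c : {ffun 'I_n -> nat}.
Hypothesis c_proper : proper_coloring G c.

(* An edge between non-consecutive vertices closes a two-colored triangle. *)
Lemma two_colored_chordless : chordless G (two_colored c).
Proof.
apply: pairwise_chordless (pairwise_ltn_two_colored c) _ => x y z.
rewrite !mem_two_colored !inE => cx cy cz xy yz; apply/negP => Gxz.
have /andP[Gxy Gyz] := G_interval xy yz Gxz.
by move: (c_proper Gxy) (c_proper Gyz) (c_proper Gxz); lia.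
Qed.

Lemma run_alternating r :
  r \in runs G (two_colored c) -> alternating a (map c r).
Proof.
move=> rc; apply/andP; split.
  rewrite sorted_map; move: r rc; apply/allP; rewrite all_sorted_runs.
  apply: sub_sorted (pairwise_sorted (pairwise_ltn_two_colored c)) => x y _.
  exact/implyP/c_proper.
rewrite all_map; apply/allP => x xr /=; rewrite -mem_two_colored.
by rewrite -(flatten_runs G (two_colored c)); apply/flattenP; exists r.
Qed.

Lemma swap_odd_runs_proper : proper_coloring G (swap_odd_runs c).
Proof.
move=> x y Gxy; have [/andP[xV yV] | xyV] :=
    boolP ((c x \in [:: a; a.+1]) && (c y \in [:: a; a.+1])); last first.
  by rewrite neq_ltn !swap_odd_runs_ltn // 1?andbC // -neq_ltn c_proper.
pose proper_edge x y := G x y ==> (swap_odd_runs c x != swap_odd_runs c y).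
suff /allrelP/(_ x y) : all2rel proper_edge (two_colored c).
  by rewrite !mem_two_colored => /(_ xV yV); rewrite /proper_edge Gxy.
rewrite -pairwise_all2rel => [|u|u v]; first last.
- by rewrite /proper_edge adj_sym eq_sym.
- by rewrite /proper_edge adj_irr.
rewrite chordless_pairwise ?two_colored_chordless // -all_sorted_runs.
apply/allP => r rc.
have /andP[+ _] := alternating_swap_word (run_alternating rc).
by rewrite -map_swap_odd_runs // sorted_map.
Qed.

Lemma asc_two_colored (d : {ffun 'I_n -> nat}) :
  \sum_(x <- two_colored c) \sum_(y <- two_colored c)
      [&& x < y, G x y & d x < d y]
    = \sum_(r <- runs G (two_colored c)) consecutive_count ltn (map d r).
Proof.
have ltn_asym (x y : 'I_n) : relpre val ltn x y -> ~~ relpre val ltn y x.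
  by move=> /= xy; rewrite -leqNgt ltnW.
under [RHS]eq_bigr do rewrite consecutive_count_map.
rewrite -consecutive_count_runs -(chordless_sum_edges _ ltn_asym) //.
  exact: pairwise_ltn_two_colored.
exact: two_colored_chordless.
Qed.

Lemma asc_swap_odd_runs : asc G (swap_odd_runs c) = asc G c.
Proof.
rewrite !(asc_sum_split G _ (uniq_two_colored c)); congr (_ + _).
  rewrite !asc_two_colored; apply: eq_big_seq => r rc.
  by rewrite map_swap_odd_runs // consecutive_asc_swap_word // run_alternating.
by apply: eq_bigr => p; rewrite !mem_two_colored => /swap_odd_runs_ltn->.
Qed.

Lemma content_swap_odd_runs k :
  content (swap_odd_runs c) k = content c (swap_colors a k).
Proof.
case: (boolP (k \in [:: a; a.+1])) => ka.
  rewrite !content_two_colored ?mem_swap_colors // two_colored_swap_odd_runs.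
  apply: eq_big_seq => r rc.
  by rewrite map_swap_odd_runs // count_mem_swap_word // run_alternating.
rewrite swap_colors_id //; apply: eq_card => x; rewrite !inE.
have [cx | /swap_odd_runs_id->//] := boolP (c x \in [:: a; a.+1]).
have neq_k j : j \in [:: a; a.+1] -> (j == k) = false.
  by apply: contraTF => /eqP->.
by rewrite !neq_k ?mem_swap_odd_runs.
Qed.

End ProperColoring.

End OddRunSwap.

Lemma cmonom_eventually0 (m : {cmonom nat}) :
  exists N, forall k, N <= k -> m k = 0.
Proof.
exists (\max_(i <- finsupp m) i).+1 => k ltk; apply/eqP; apply: contraTT ltk.
by rewrite -mem_finsupp -ltnNge ltnS => km; apply: leq_bigmax_seq.
Qed.

Local Open Scope ring_scope.

Lemma reindex_fsbig_can (R : Type) (idx : R) (op : Monoid.com_law idx)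
    (I J : choiceType) (h : I -> J) (g : J -> I) (A : set I) (B : set J)
    (F : J -> R) :
    set_fun A B h -> set_fun B A g ->
    {in A, cancel h g} -> {in B, cancel g h} ->
  \big[op/idx]_(j \in B) F j = \big[op/idx]_(i \in A) F (h i).
Proof.
move=> hAB gBA hK gK; apply: reindex_fsbig; split=> //.
  exact: can_in_inj hK.
by move=> j Bj; exists (g j); [apply: gBA | apply/gK/mem_set].
Qed.

Arguments reindex_fsbig_can {R idx op I J} h g A {B F}.

Section AscentPolynomial.

Variables (n : nat) (G : simple_graph n).
Implicit Type c : {ffun 'I_n -> nat}.

Definition colorings_with_content (m : nat -> nat) : set {ffun 'I_n -> nat} :=
  [set c | proper_coloring G c /\ content c =1 m]%classic.

Definition asc_poly (m : nat -> nat) : {poly int} :=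
  \sum_(c \in colorings_with_content m) ('X^(asc G c) : {poly int}).

Lemma chromatic_qsymE m : chromatic_qsym G m = asc_poly m.
Proof.
rewrite /asc_poly; suff -> : colorings_with_content m =
  [set c | proper_coloring G c /\ color_monomial c = m]%classic by [].
by apply/seteqP; split=> c [c_proper /color_monomial_content cm].
Qed.

Lemma finite_colorings_with_content m : finite_set (colorings_with_content m).
Proof.
have [->|/set0P[c0 [_ c0m]]] := eqVneq (colorings_with_content m) set0.
  exact: finite_set0.
have := @finite_color_monomial n (color_monomial c0).
apply: sub_finite_set => c [_ cm].
by apply/color_monomial_content => k; rewrite cm color_monomialE -c0m.
Qed.

Lemma coef_asc_poly_neq0 m j :
  (asc_poly m)`_j != 0 <-> exists2 c, colorings_with_content m c & asc G c = j.
Proof.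
rewrite /asc_poly fsbig_finite; last exact: finite_colorings_with_content.
rewrite coef_sum; under eq_bigr do rewrite coefXn.
rewrite psumr_neq0 //; split=> [/hasP[c] | [c cm <-]].
  rewrite in_fset_set ?inE; last exact: finite_colorings_with_content.
  by move=> cm; rewrite ltr0n lt0b => /eqP->; exists c.
apply/hasP; exists c; last by rewrite eqxx ltr01.
by rewrite in_fset_set ?inE //; apply: finite_colorings_with_content.
Qed.

Lemma size_asc_poly m : (size (asc_poly m) <= #|edges G|.+1)%N.
Proof.
apply/leq_sizeP => j lt_j; apply/eqP; apply: contraTT lt_j.
by move=> /coef_asc_poly_neq0[c _ <-]; rewrite -leqNgt asc_le_edges.
Qed.

Lemma asc_poly_rev (s : seq nat) :
  asc_poly (nth 0%N (rev s))
    = \sum_(c \in colorings_with_content (nth 0%N s))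
        ('X^(#|edges G| - asc G c) : {poly int}).
Proof.
pose reverse := @reverse_coloring n (size s).
have reverse_content t c : colorings_with_content (nth 0%N t) c ->
    colorings_with_content (nth 0%N (rev t)) (reverse_coloring (size t) c).
  move=> [c_proper ct]; split; last exact: content_reverse_coloring.
  exact/reverse_coloring_proper/c_proper/content_lt.
rewrite /asc_poly (reindex_fsbig_can reverse reverse
                     (colorings_with_content (nth 0%N s))).
- apply: eq_fsbigr => c /set_mem[c_proper /content_lt ltcs].
  by rewrite asc_reverse_coloring.
- exact: reverse_content.
- by move=> c /(reverse_content _ _); rewrite revK size_rev.
- by move=> c /set_mem[_ /content_lt]; apply: reverse_coloringK.
- move=> c /set_mem[_ /content_lt]; rewrite size_rev.
  exact: reverse_coloringK.
Qed.

Lemma coef_asc_poly_rev (s : seq nat) j : (j <= #|edges G|)%N ->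
  (asc_poly (nth 0%N (rev s)))`_j = (asc_poly (nth 0%N s))`_(#|edges G| - j).
Proof.
move=> le_j; rewrite asc_poly_rev /asc_poly.
rewrite !fsbig_finite; try exact: finite_colorings_with_content.
rewrite !coef_sum; apply: eq_bigr => c _; rewrite !coefXn.
by congr (_ %:R); move: (asc_le_edges G c); lia.
Qed.

Section UnitInterval.

Hypothesis G_interval : unit_interval_graph G.

Lemma asc_poly_swap_colors a (m : nat -> nat) :
  asc_poly (m \o swap_colors a) = asc_poly m.
Proof.
have swap_content m' c : colorings_with_content m' c ->
    colorings_with_content (m' \o swap_colors a) (swap_odd_runs G a c).
  move=> [c_proper cm']; split; first exact: swap_odd_runs_proper.
  by move=> k; rewrite content_swap_odd_runs // cm'.
have swapK : (m \o swap_colors a) \o swap_colors a = m.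
  by apply/funext => k /=; rewrite swap_colorsK.
rewrite {1}/asc_poly (reindex_fsbig_can (swap_odd_runs G a)
  (swap_odd_runs G a) (colorings_with_content m)).
- by apply: eq_fsbigr => c /set_mem[c_proper _]; rewrite asc_swap_odd_runs.
- exact: swap_content.
- by move=> c /swap_content; rewrite swapK.
- by move=> c _; apply: swap_odd_runsK.
- by move=> c _; apply: swap_odd_runsK.
Qed.

Lemma asc_poly_perm (s s' : seq nat) : perm_eq s s' ->
  asc_poly (nth 0%N s) = asc_poly (nth 0%N s').
Proof.
move: s s'; apply: adjacent_swap_perm_subst => s1 x y s2.
rewrite -(asc_poly_swap_colors (size s1)).
by congr asc_poly; apply/funext => k; rewrite nth_cat_swap.
Qed.

Lemma chromatic_qsym_sym (s : nat -> nat) (m m' : {cmonom nat}) :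
    bijective s -> (forall k, m' k = m (s k)) ->
  chromatic_qsym G m' = chromatic_qsym G m.
Proof.
move=> bij_s m'E; have [N m0] := cmonom_eventually0 m.
have [N' m'0] := cmonom_eventually0 m'; pose M := maxn N N'.
have m0M k : (M <= k)%N -> m k = 0%N by rewrite geq_max => /andP[/m0].
have m'0M k : (M <= k)%N -> m (s k) = 0%N.
  by rewrite -m'E geq_max => /andP[_ /m'0].
rewrite !chromatic_qsymE (funext m'E) -(funext (nth_mkseq_default m'0M)).
rewrite -[X in _ = asc_poly X](funext (nth_mkseq_default m0M)).
exact/asc_poly_perm/(perm_mkseq_comp bij_s m0M m'0M).
Qed.

Lemma coef_chromatic_qsym_rev (m : {cmonom nat}) j : (j <= #|edges G|)%N ->
  (chromatic_qsym G m)`_j = (chromatic_qsym G m)`_(#|edges G| - j).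
Proof.
move=> le_j; have [N m0] := cmonom_eventually0 m.
rewrite !chromatic_qsymE -(funext (nth_mkseq_default m0)) -coef_asc_poly_rev //.
by rewrite (@asc_poly_perm (rev _) (mkseq m N)) // perm_rev.
Qed.

Lemma symmetric_coef_chromatic_qsym j :
  symmetric_function (fun m => (chromatic_qsym G m)`_j).
Proof.
split; last by move=> s m m' bij_s m'E; rewrite (chromatic_qsym_sym bij_s m'E).
exists n => m; rewrite chromatic_qsymE => /coef_asc_poly_neq0[c [_ cm] _].
have <- : color_monomial c = m by apply/color_monomial_content.
rewrite mdeg_prod (eq_bigr (fun=> 1%N)) => [|i _]; last exact: mdegU.
by rewrite sum1_card card_ord.
Qed.

End UnitInterval.

Lemma coef_chromatic_qsym_edges_neq0 :
  exists m, (chromatic_qsym G m)`_#|edges G| != 0.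
Proof.
pose c := [ffun i : 'I_n => val i]; exists (color_monomial c).
rewrite chromatic_qsymE; apply/coef_asc_poly_neq0; exists c.
  split=> [i j Gij | ]; last exact/color_monomial_content.
  by rewrite !ffunE val_eqE; apply: contraTneq Gij => ->; rewrite adj_irr.
by apply: eq_card => p; rewrite !inE !ffunE andbb.
Qed.

End AscentPolynomial.

Theorem theorem4p5 (n : nat) (P : poset n) :
  natural_unit_interval_order P -> palindromic (chromatic_qsym (inc P)).
Proof.
move=> /inc_unit_interval_graph G_interval; pose G := inc P.
exists #|edges G|, (fun j m => (chromatic_qsym G m)`_j); split.
- move=> m; rewrite -/(take_poly _ _) take_poly_id //.
  by rewrite chromatic_qsymE size_asc_poly.
- by move=> j _; apply: symmetric_coef_chromatic_qsym.
- exact: coef_chromatic_qsym_edges_neq0.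
- by move=> j le_j m; apply: coef_chromatic_qsym_rev.
Qed.
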